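(* Let $T>0$, $\nu>0$, and let $V,S:\mathbb{R}^n\to\mathbb{R}$ with $V$ bounded and Lipschitz and $S$ Lipschitz, and such that, for the controlled process $Z$, $P\left(\int_0^T|V(Z_s)|\,ds<\infty\right)=1$ and $P(|S(Z_T)|<\infty)=1$. Let $U_t(x)$ be the value process $$U_t(x)=\operatorname*{ess\,inf}_{u\in\mathcal{U}}\left\{\int_t^T\left(\frac{|u(\omega,s)|^2}{2}+V(Z_s)\right)ds+S(Z_T)\right\}.$$ Let $0\le t\le T$, let $\delta\ge 0$ be a constant such that $t+\delta\le T$, and for $x\in\mathbb{R}^n$ set $$\tilde U_t(x)=\operatorname*{ess\,inf}_{u\in\mathcal{U}}\left\{\int_t^{t+\delta}\left(\frac{|u(\omega,s)|^2}{2}+V(Z_s)\right)ds+U_{t+\delta}(Z_{t+\delta})\right\}.$$ Then $\tilde U_t=U_t$ (i.e. $\tilde U_t(x)=U_t(x)$ almost surely for every $x\in\mathbb{R}^n$).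
   Context: Setting. $W$ is a standard Brownian motion in $\mathbb{R}^n$ on $[0,T]$, realized on the classical Wiener space $\Omega$ of continuous paths (topology of uniform convergence, $\sigma$-algebra generated by cylindrical sets, $P$ = Wiener measure). Controls. Fix a constant $C>0$. $\mathcal{U}$ is the set of all measurable $\mathbb{R}^n$-valued processes $u(\omega,s)$, not necessarily adapted to any filtration, with $\|u(\omega,\cdot)\|_{L^\infty(0,T)}\le C$ for almost every $\omega$. For $0\le t\le T$, $x\in\mathbb{R}^n$ and $u\in\mathcal{U}$, the controlled process is $Z_s=Z_s^{t,x,u}=x+\int_t^s u(\omega,r)\,dr+\sqrt{\nu}\,(W(s)-W(t))$, $t\le s\le T$; in both displays of the claim $Z=Z^{t,x,u}$. For each $(t,x)$, $U_t(x)$ is an essential infimum of a family of random variables, hence defined up to null sets; $U_{t+\delta}(Z_{t+\delta})$ is the evaluation at the random point $Z_{t+\delta}$ of a continuous version of $x\mapsto U_{t+\delta}(x)$. *)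

(* Defs.v *)
From HB Require Import structures.
From mathcomp Require Import all_boot all_order all_algebra.
From mathcomp Require Import all_classical all_reals all_analysis measurable_realfun.

Set Implicit Arguments.
Unset Strict Implicit.
Unset Printing Implicit Defensive.

Import Order.TTheory GRing.Theory Num.Theory.
Import numFieldNormedType.Exports.

Local Open Scope classical_set_scope.
Local Open Scope ring_scope.

(* The library norm `|v| of a row vector is the sup norm; costs and control
   bounds use the Euclidean one. *)
Definition enorm (R : realType) (n : nat) (v : 'rV[R]_n) : R :=
  Num.sqrt (\sum_(i < n) v ord0 i ^+ 2).

Definition path_space (R : realType) (n : nat) (T : R) : Type :=
  continuousType (set_type `[0, T]%classic) 'rV[R]_n.

Section path_space_instances.
Context (R : realType) (n : nat) (T : R).

Definition zero_path : path_space n T :=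
  mkcts (@cst_continuous (set_type `[0, T]%classic) 'rV[R]_n 0).

HB.instance Definition _ := Choice.on (path_space n T).
HB.instance Definition _ := isPointed.Build (path_space n T) zero_path.

End path_space_instances.

Definition cylinder (R : realType) (n : nat) (T : R) :
    set (set (path_space n T)) :=
  [set A | exists (k : nat) (s : 'I_k -> set_type `[0, T]%classic)
             (B : 'I_k -> set 'rV[R]_n),
     (forall j, <<s @open 'rV[R]_n >> (B j)) /\
     A = [set w : path_space n T | forall j, B j (w (s j))]].
Arguments cylinder {R} n T.

Definition wiener_space (R : realType) (n : nat) (T : R) :=
  g_sigma_algebraType (cylinder n T).
Arguments wiener_space {R} n T.

(* Coordinate process W(s), extended by 0 to times s outside [0, T]. *)
Definition Wproc (R : realType) (n : nat) (T : R) (s : R)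
    (w : wiener_space n T) : 'rV[R]_n :=
  'valL_0 (w : set_type `[0, T]%classic -> 'rV[R]_n) s.

(* P is the law of a standard Brownian motion on [0, T]. The product formula
   says that the increments over consecutive intervals, and the coordinates of
   each increment, are jointly independent, and that every coordinate of
   W(t') - W(t) has law N(0, t' - t); the second argument of normal_prob is the
   standard deviation. *)
Definition is_wiener_measure (R : realType) (n : nat) (T : R)
    (P : probability (wiener_space n T) R) : Prop :=
  {ae P, forall w, Wproc 0 w = 0} /\
  forall (k : nat) (tau : nat -> R),
    0 <= tau 0%N -> (forall j, (j < k)%N -> tau j < tau j.+1) -> tau k <= T ->
  forall A : 'I_k -> 'I_n -> set R, (forall j i, measurable (A j i)) ->
    P [set w | forall (j : 'I_k) (i : 'I_n),
                 A j i ((Wproc (tau j.+1) w - Wproc (tau j) w) ord0 i)] =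
    (\prod_(j < k) \prod_(i < n)
       normal_prob 0 (Num.sqrt (tau j.+1 - tau j)) (A j i))%E.

(* Essential infimum of the family (Y i), i in A; it is unique only up to
   P-null sets, hence a relation. *)
Definition is_ess_inf d (Omega : measurableType d) (R : realType)
    (P : {measure set Omega -> \bar R}) (I : Type) (A : set I)
    (Y : I -> Omega -> \bar R) (X : Omega -> \bar R) : Prop :=
  [/\ measurable_fun setT X,
      forall i, A i -> {ae P, forall w, (X w <= Y i w)%E} &
      forall X' : Omega -> \bar R, measurable_fun setT X' ->
        (forall i, A i -> {ae P, forall w, (X' w <= Y i w)%E}) ->
        {ae P, forall w, (X' w <= X w)%E}].

Definition is_continuous_version d (Omega : measurableType d) (R : realType)
    (P : {measure set Omega -> \bar R}) (n : nat)
    (U : 'rV[R]_n -> Omega -> \bar R) (Uc : 'rV[R]_n -> Omega -> R) : Prop :=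
  (forall x, {ae P, forall w, (Uc x w)%:E = U x w}) /\
  {ae P, forall w, continuous (fun x => Uc x w)}.

Section control_problem.
Context (R : realType) (n : nat) (T : R).
Local Notation Omega := (wiener_space n T).
Local Notation mu := (@lebesgue_measure R).

Definition Linfty_norm (f : R -> 'rV[R]_n) : \bar R :=
  Lnorm (mrestr mu (measurable_itv `]0, T[)) +oo%E
    (fun s => (enorm (f s))%:E).

Definition controls (P : {measure set Omega -> \bar R}) (C : R) :
    set (Omega -> R -> 'rV[R]_n) :=
  [set u | measurable_fun ([set: Omega] `*` `[0, T])
             (fun p : Omega * R =>
                u p.1 p.2 : g_sigma_algebraType (@open 'rV[R]_n)) /\
           {ae P, forall w, (Linfty_norm (u w) <= C%:E)%E}].

Definition controlled (nu t : R) (x : 'rV[R]_n) (u : Omega -> R -> 'rV[R]_n)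
    (s : R) (w : Omega) : 'rV[R]_n :=
  x + \row_(i < n) \int[mu]_(r in `[t, s]) u w r ord0 i
    + Num.sqrt nu *: (Wproc s w - Wproc t w).

Definition running_cost (nu : R) (V : 'rV[R]_n -> R) (t b : R) (x : 'rV[R]_n)
    (u : Omega -> R -> 'rV[R]_n) (w : Omega) : R :=
  \int[mu]_(s in `[t, b])
    (enorm (u w s) ^+ 2 / 2 + V (controlled nu t x u s w)).

Definition is_value_process (P : {measure set Omega -> \bar R}) (C nu : R)
    (V S : 'rV[R]_n -> R) (U : R -> 'rV[R]_n -> Omega -> \bar R) : Prop :=
  forall t x, 0 <= t <= T ->
    is_ess_inf P (controls P C)
      (fun u w => (running_cost nu V t T x u w
                   + S (controlled nu t x u T w))%:E)
      (U t x).

End control_problem.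

(* Main.v *)
Require Import Defs.
From mathcomp Require Import all_boot all_order all_algebra.
From mathcomp Require Import all_classical all_reals all_analysis measurable_realfun.
From mathcomp Require Import ess_sup_inf ring lra.

(* Write t1 = t + delta, Z = Z_{t1} and J(s, y, u) for the cost of u from (s, y).
   Additivity of the cost gives J(t, x, u) = cost on [t, t1] + J(t1, Z, u) path by
   path, and J(t1, ., u) is Lipschitz with a constant L independent of u.
   For Utilde <= U: almost surely Uc q <= J(t1, q, u) for all rational q, hence
   Uc Z <= J(t1, Z, u) by continuity.
   For U <= Utilde no measurable selection of near-optimal controls is needed.
   Given u, let M be U_t(x) minus the cost of u on [t, t1]. Following u up to t1 and
   an arbitrary v afterwards shows M - L |Z - q| <= J(t1, q, v) for every v; as the
   left-hand side is a measurable random variable, it is below the essential infimum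
   Uc q, almost surely for all rational q, and letting q tend to Z gives M <= Uc Z. *)

Set Implicit Arguments.
Unset Strict Implicit.
Unset Printing Implicit Defensive.

Import Order.TTheory GRing.Theory Num.Theory.
Import numFieldNormedType.Exports.

Local Open Scope classical_set_scope.
Local Open Scope ring_scope.

(** * Rational points and measurability of vector-valued maps *)

Section rational_points.
Context {R : realType} {n : nat}.
Implicit Types (x z : 'rV[R]_n) (q : 'rV[rat]_n).

Definition rat_row q : 'rV[R]_n := map_mx ratr q.

Lemma rat_row_dense z (e : R) : 0 < e -> exists q, `|z - rat_row q| < e.
Proof.
move=> e0.
have /choice[f fP] (i : 'I_n) : exists r : rat, `|z ord0 i - ratr r| < e.
  have [||y [/= zr [r _ ry]]] := @dense_rat R (ball (z ord0 i) e).
  - by exists (z ord0 i); exact: ballxx.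
  - exact: ball_open.
  - by exists r; rewrite ry.
exists (\row_i f i).
have : ball z e (rat_row (\row_i f i)).
  by split=> // i j; rewrite !mxE ord1; exact: fP.
by rewrite mx_norm_ball.
Qed.

(** There are countably many rational rows, so their null sets merge into one. Indices that code no
    row are read as the row 0. *)
Lemma ae_rat_row d (Omega : measurableType d)
    (P : {measure set Omega -> \bar R}) (Q : 'rV[R]_n -> Omega -> Prop) :
  (forall x, {ae P, forall w, Q x w}) ->
  {ae P, forall w, forall q, Q (rat_row q) w}.
Proof.
move=> aeQ.
have := @ae_foralln _ _ _ P (fun k w => Q (rat_row (odflt 0 (unpickle k))) w)
  (fun k => aeQ _).
apply: filterS => w Qw q.
by have := Qw (pickle q); rewrite pickleK.
Qed.

(** Let rational rows tend to [z]: the error term vanishes and [f] converges. This carries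
    inequalities from rational points to the random point [Z]. *)
Lemma ler_rat_row_limit (f : 'rV[R]_n -> R) (c K : R) z : {for z, continuous f} ->
  (forall q, f (rat_row q) <= c + K * `|z - rat_row q|) -> f z <= c.
Proof.
move=> fz fq; apply/ler_addgt0Pr => e e0.
have e20 : 0 < e / 2 by rewrite divr_gt0.
have K0 : 0 < `|K| + 1 by rewrite ltr_wpDl.
have /cvgr_dist_lt/(_ _ e20)/nbhs_ballP[r /= r0 rf] := fz.
(* Within this radius both the oscillation of [f] and the error term stay below [e / 2]; [|K| + 1]
   is positive and dominates [K]. *)
have m0 : 0 < Num.min r (e / 2 / (`|K| + 1)) by rewrite lt_min r0 divr_gt0.
have [q] := rat_row_dense z m0; rewrite lt_min => /andP[zr].
rewrite ltr_pdivlMr// => zK.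
have /rf : ball z r (rat_row q) by rewrite mx_norm_ball.
rewrite ltr_distlC => /andP[+ _] => /ltW; rewrite lerBlDr => /le_trans; apply.
rewrite [in leRHS](splitr e) addrA lerD2r.
apply: (le_trans (fq q)); rewrite lerD2l; apply: le_trans (ltW zK).
rewrite mulrC; apply: ler_wpM2l => //.
by rewrite (le_trans (ler_norm K))// lerDl.
Qed.

End rational_points.

Section measurable_rV.
Context {R : realType} {n : nat} {d : measure_display} {T : measurableType d}.
Implicit Types (D : set T) (z : T -> 'rV[R]_n).

Lemma measurable_fun_coord D z i :
  measurable_fun D (z : T -> g_sigma_algebraType (@open 'rV[R]_n)) ->
  measurable_fun D (fun x => z x ord0 i).
Proof.
move=> mz mD; move: (mD).
apply: (measurability _ (@RGenOpens.measurableE R)) => _ [_ [a [b ->]] <-].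
apply: (mz mD ((fun v : 'rV[R]_n => v ord0 i) @^-1` `]a, b[)).
apply: sub_sigma_algebra; apply: open_comp => [v _|]; last exact: itv_open.
exact: coord_continuous.
Qed.

(** The preimage of an open interval under [V] is open, hence a countable union of boxes with
    rational centres and radii [1/(k+1)]; each box is a finite conjunction of conditions on
    coordinates. *)
Lemma measurable_continuous_rV D z (V : 'rV[R]_n -> R) : measurable D ->
  (forall i, measurable_fun D (fun x => z x ord0 i)) -> continuous V ->
  measurable_fun D (V \o z).
Proof.
move=> mD mz cV.
apply: (measurability _ (@RGenOpens.measurableE R)) => _ [_ [a [b ->]] <-].
rewrite comp_preimage.
have : open (V @^-1` `]a, b[) by apply: open_comp => [v _|]; [exact: cV|exact: itv_open].
move: (V @^-1` _) => G oG.
pose box (c : 'rV[rat]_n * nat) : set 'rV[R]_n :=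
  [set v | forall i, `|v ord0 i - ratr (c.1 ord0 i)| < c.2.+1%:R^-1].
(* Boxes not contained in [G] contribute the empty set, so the union runs over the whole countable
   index type. *)
pose F c : set T := if `[< box c `<=` G >] then D `&` z @^-1` box c else set0.
have -> : D `&` z @^-1` G = \bigcup_c F c.
  apply/seteqP; split=> [x [Dx Gzx]|x [c _]]; last first.
    by rewrite /F; case: asboolP => // cG [Dx /cG].
  have : nbhs (z x) G by exact: open_nbhs_nbhs.
  move/nbhs_ballP => [e /= e0 eG].
  have e20 : 0 < e / 2 by rewrite divr_gt0.
  near (\oo : set_system nat) => k.
  have ke : k.+1%:R^-1 < e / 2 by near: k; exact: near_infty_natSinv_lt (PosNum e20).
  have k0 : 0 < k.+1%:R^-1 :> R by rewrite invr_gt0.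
  have [q zq] := rat_row_dense (z x) k0.
  have zqi i : `|z x ord0 i - ratr (q ord0 i)| < k.+1%:R^-1.
    have : ball (z x) k.+1%:R^-1 (rat_row q) by rewrite mx_norm_ball.
    by move=> [_ /(_ ord0 i)]; rewrite mxE.
  exists (q, k) => //; rewrite /F asboolT; first by split.
  move=> v /= vq; apply: eG; split=> // i j; rewrite ord1 /ball /= (splitr e).
  rewrite -(subrKA (ratr (q ord0 j))) (le_lt_trans (ler_normD _ _))//.
  rewrite ltrD//; first by rewrite (lt_trans (zqi j)).
  by rewrite distrC (lt_trans (vq j)).
apply: countable_bigcupT_measurable => [|c]; first exact: countableP.
rewrite /F; case: asboolP => // _.
(* The outer [D] matters for [n = 0], where the intersection is the whole space. *)
have -> : D `&` z @^-1` box c = D `&` \bigcap_(i in [set: 'I_n])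
    (D `&` (fun x => z x ord0 i) @^-1` (ball (ratr (c.1 ord0 i) : R) c.2.+1%:R^-1)).
  apply/seteqP; split=> x [Dx zc]; split=> // i.
    by move=> _; split=> //; rewrite /ball /= distrC; exact: zc.
  by have [//|_ /=] := zc i; rewrite /ball /= distrC.
apply: measurableI => //; apply: fin_bigcap_measurable => // i _.
by apply: mz => //; apply: open_measurable; exact: ball_open.
Unshelve. all: by end_near.
Qed.

End measurable_rV.

(** * Joint measurability *)

Section parametric_integral.
Context {R : realType} {d : measure_display} {X : measurableType d}.
Local Notation mu := (@lebesgue_measure R).

(** Tonelli applies to the positive and the negative part separately, and [fine] keeps their
    difference measurable even where it is infinite. *)
Lemma measurable_fun_parametric_Rintegral (h : X * R -> R) :
  measurable_fun setT h -> measurable_fun setT (fun x => \int[mu]_r h (x, r)).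
Proof.
move=> mh; rewrite /Rintegral.
apply: (measurableT_comp (@fine_measurable R setT measurableT)).
have mEh : measurable_fun setT (EFin \o h) by exact/measurable_EFinP.
under eq_fun do rewrite integralE.
apply: emeasurable_funB.
- have := @measurable_fun_fubini_tonelli_F _ _ _ _ _ mu _ (measurable_funepos mEh)
    (funepos_ge0 _).
  by congr measurable_fun; apply/funext => x; apply: eq_integral => r _; rewrite !funeposE.
- have := @measurable_fun_fubini_tonelli_F _ _ _ _ _ mu _ (measurable_funeneg mEh)
    (funeneg_ge0 _).
  by congr measurable_fun; apply/funext => x; apply: eq_integral => r _; rewrite !funenegE.
Qed.

End parametric_integral.

Section strip.
Context {R : realType} {d : measure_display} {X : measurableType d} {T : R}.
Local Notation mu := (@lebesgue_measure R).
Local Notation D := ([set: X] `*` `[0, T]).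

Lemma measurable_strip : measurable D.
Proof. by apply: measurableX => //; exact: measurable_itv. Qed.

Lemma measurable_fun_Rintegral_itv (t : R) (g : X * R -> R) : 0 <= t ->
  measurable_fun D g ->
  measurable_fun D (fun p => \int[mu]_(r in `[t, p.2]) g (p.1, r)).
Proof.
move=> t0 /(measurable_restrictT _ measurable_strip) mg.
(* The moving bound of integration becomes a condition inside the integrand, a function of the
   triple ((x, s), r), so that the integral runs over all of R. *)
pose h (x : (X * R) * R) : R :=
  if (t <= x.2) && (x.2 <= x.1.2) then (g \_ D) (x.1.1, x.2) else 0.
have mh : measurable_fun setT h.
  apply: measurable_fun_ifT => //.
  - apply: measurable_and.
      apply: measurable_fun_ler => //; exact: measurable_snd.
    apply: measurable_fun_ler; first exact: measurable_snd.
    exact: measurableT_comp measurable_snd measurable_fst.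
  - apply: (measurableT_comp mg); apply: measurable_fun_pair.
      exact: measurableT_comp measurable_fst measurable_fst.
    exact: measurable_snd.
apply: (eq_measurable_fun (fun p => \int[mu]_r h (p, r))); last first.
  by apply: measurable_funTS; exact: measurable_fun_parametric_Rintegral.
move=> [x s]; rewrite inE /= => -[_ /=]; rewrite in_itv/= => /andP[s0 sT].
rewrite [in RHS]Rintegral_mkcond; apply: eq_Rintegral => r _.
rewrite /h /= /patch.
have -> : (r \in `[t, s]%classic) = (t <= r <= s).
  by apply/idP/idP; rewrite inE /= in_itv.
case: ifPn => // /andP[tr rs].
rewrite mem_set//=; split => //=.
by rewrite in_itv/= (le_trans t0)//= (le_trans rs).
Qed.

Lemma measurable_fun_strip_fst (g : X * R -> R) s : 0 <= s <= T ->
  measurable_fun D g -> measurable_fun setT (fun x => g (x, s)).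
Proof.
move=> sT mg; apply: (measurable_comp (F := D) measurable_strip) mg _.
  by move=> _ [x _ <-]; split=> //=; rewrite in_itv.
exact: pair2_measurable.
Qed.

Lemma measurable_fun_strip_snd (g : X * R -> R) x :
  measurable_fun D g -> measurable_fun `[0, T] (fun s => g (x, s)).
Proof.
move=> mg; apply: (measurable_comp (F := D) measurable_strip) mg _.
  by move=> _ [s sT <-].
by apply: measurable_funTS; exact: pair1_measurable.
Qed.

(* Approximate [f x s] by its value at the grid point of mesh [1/m] below [s]. *)
Lemma measurable_fun_caratheodory (f : X -> R -> R) :
  (forall s, measurable_fun setT (f^~ s)) -> (forall x, continuous (f x)) ->
  measurable_fun setT (fun p : X * R => f p.1 p.2).
Proof.
move=> mf cf.
pose fl (m : nat) (s : R) : int := Num.floor (s * m.+1%:R).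
pose fa m (p : X * R) := f p.1 ((fl m p.2)%:~R / m.+1%:R).
apply: (@measurable_fun_cvg _ _ _ _ fa) => [m|[x s] _].
  move=> _ B mB; rewrite setTI.
  (* On the time slab where the grid index is [k] the approximation does not depend on time, so the
     preimage is a countable union of rectangles. *)
  have -> : fa m @^-1` B = \bigcup_(k : int)
      ((f^~ (k%:~R / m.+1%:R) @^-1` B) `*`
       `[k%:~R / m.+1%:R, (k + 1)%:~R / m.+1%:R[).
    apply/seteqP; split=> [[x s] /= Bs|[x s] [k _ [/= Bx]]].
      exists (fl m s) => //; split => //=.
      by rewrite in_itv/= ler_pdivrMr// ltr_pdivlMr// floor_le_tmp floorD1_gt.
    rewrite in_itv/= ler_pdivrMr// ltr_pdivlMr// /fa /= => ks.
    by have -> : fl m s = k by apply/floor_def.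
  apply: countable_bigcupT_measurable => [|k]; first exact: countableP.
  apply: measurableX; last exact: measurable_itv.
  by rewrite -[X in measurable X]setTI; exact: mf.
suff fls : (fl m s)%:~R / m.+1%:R @[m --> \oo] --> s by exact: cvg_comp fls (cf x s).
apply/cvgrPdist_lt => e e0; near=> m.
have me : m.+1%:R^-1 < e by near: m; exact: near_infty_natSinv_lt (PosNum e0).
apply: le_lt_trans me; rewrite ger0_norm; last first.
  by rewrite subr_ge0 ler_pdivrMr// floor_le_tmp.
rewrite lerBlDl -[X in _ + X]mul1r -mulrDl ler_pdivlMr//.
by rewrite -(intrD _ _ 1) ltW// floorD1_gt.
Unshelve. all: by end_near.
Qed.

End strip.

Section wiener_measurability.
Context {R : realType} {n : nat} {T : R}.

Lemma WprocE s (sT : s \in `[0, T]%classic) (w : wiener_space n T) :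
  Wproc s w = (w : path_space n T) (exist _ s sT).
Proof.
exact: (congr1 (fun f => f (exist _ s sT)) (valLK 0 (w : set_type `[0, T]%classic -> 'rV[R]_n))).
Qed.

Lemma measurable_Wproc s i :
  measurable_fun setT (fun w : wiener_space n T => Wproc s w ord0 i).
Proof.
have [sT|sT] := boolP (s \in `[0, T]%classic).
  under eq_fun do rewrite WprocE.
  move=> _ B mB; rewrite setTI; apply: sub_sigma_algebra.
  (* The preimage is a cylinder over the single time [s]. *)
  exists 1%N, (fun=> exist _ s sT), (fun=> (fun v : 'rV[R]_n => v ord0 i) @^-1` B).
  split=> [_|].
    have := @measurable_fun_coord R n _ (g_sigma_algebraType (@open 'rV[R]_n)) setT id i.
    move=> /(_ (@measurable_id _ _ _) measurableT B mB).
    by rewrite setTI.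
  by apply/seteqP; split=> w /= => [wB _|/(_ ord0)].
have -> : (fun w : wiener_space n T => Wproc s w ord0 i) = cst 0.
  apply/funext => w; by rewrite /Wproc /valL_ oinv_set_val /= insubN//= mxE.
exact: measurable_cst.
Qed.

(* The path is stopped outside [0, T] to make it continuous on R. *)
Lemma measurable_Wproc_strip i :
  measurable_fun ([set: wiener_space n T] `*` `[0, T])
    (fun p => Wproc p.2 p.1 ord0 i).
Proof.
have [T0|T0] := ltP T 0.
  rewrite (_ : _ `*` _ = set0); first exact: measurable_fun_set0.
  by apply/seteqP; split=> // -[w s] [_ /=]; rewrite in_itv/= => /andP[/le_trans h/h]; rewrite leNgt T0.
pose clamp s : R := Num.max 0 (Num.min s T).
have clampE s : s \in `[0, T] -> clamp s = s.
  by rewrite in_itv/= => /andP[s0 sT]; rewrite /clamp (min_idPl sT) (max_idPr s0).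
have clampT s : clamp s \in `[0, T]%classic.
  by rewrite inE /= in_itv/= /clamp le_max lexx/= ge_max T0 ge_min lexx orbT.
apply: (eq_measurable_fun (fun p => Wproc (clamp p.2) p.1 ord0 i)).
  by move=> [w s]; rewrite inE => -[_ /= sT]; rewrite clampE.
apply: measurable_funTS.
apply: (measurable_fun_caratheodory (f := fun w s => Wproc (clamp s) w ord0 i)) => [s|w].
  exact: measurable_Wproc.
have -> : (fun s => Wproc (clamp s) w ord0 i) =
  (fun v : 'rV[R]_n => v ord0 i) \o ((w : path_space n T) \o (fun s => exist _ (clamp s) (clampT s))).
  by apply/funext => s /=; rewrite WprocE.
move=> s; apply: continuous_comp; last exact: coord_continuous.
apply: continuous_comp; last exact: cts_fun.
(* The subtype [0, T] has the initial topology of its inclusion, so continuity of the real-valued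
   clamp suffices. *)
apply: continuous_comp_initial => {}s.
have cmin : {for s, continuous (fun s : R => Num.min s T : R^o)}.
  by apply: (@normed_module.continuous_min _ _ id (cst T)); [exact: cvg_id|exact: cst_continuous].
exact: (@normed_module.continuous_max _ _ (cst 0) (fun s => Num.min s T) s (@cst_continuous _ _ 0 s)).
Qed.
End wiener_measurability.

(** * Costs of controls *)

Section lebesgue_intervals.
Context {R : realType}.
Local Notation mu := (@lebesgue_measure R).
Implicit Types (f g : R -> R) (a b c : R).

Lemma lebesgue_ae_mono (Q1 Q2 : R -> Prop) : (forall s, Q1 s -> Q2 s) ->
  {ae mu, forall s, Q1 s} -> {ae mu, forall s, Q2 s}.
Proof. exact: (@filterS _ _ (ae_filter_ringOfSetsType mu)). Qed.

Lemma ae_bounded_integrable (D : set R) f K : measurable D -> (mu D < +oo)%E ->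
  measurable_fun D f -> {ae mu, forall s, D s -> `|f s| <= K} ->
  mu.-integrable D (EFin \o f).
Proof.
move=> mD muD mf fK.
have mEf : measurable_fun D (EFin \o f) by exact/measurable_EFinP.
apply/integrableP; split => //.
(* The absolute value keeps the majorant nonnegative: on a null set [D], [K] may be negative. *)
apply: (@le_lt_trans _ _ (\int[mu]_(s in D) (cst `|K|%:E) s)%E).
  apply: ae_ge0_le_integral => //.
  - exact: measurableT_comp.
  - by move=> s _; rewrite lee_fin.
  - apply: (lebesgue_ae_mono _ fK) => s /[apply] fsK; rewrite lee_fin.
    exact: le_trans fsK (ler_norm _).
by rewrite integral_cst// lte_mul_pinfty.
Qed.

Lemma Rintegral_itv_split f a b c : a <= b -> b <= c ->
  mu.-integrable `[a, c] (EFin \o f) ->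
  \int[mu]_(s in `[a, c]) f s =
  \int[mu]_(s in `[a, b]) f s + \int[mu]_(s in `[b, c]) f s.
Proof.
move=> ab bc fi.
have -> : \int[mu]_(s in `[b, c]) f s = \int[mu]_(s in `]b, c]) f s.
  rewrite Rintegral_itv_obnd_cbnd//; apply: integrableS fi => //.
  by apply: subset_itvr; rewrite bnd_simp.
by rewrite -(Rintegral_itvB fi) ?bnd_simp// addrC subrK.
Qed.

(** The endpoint [a] is a null set. This serves spliced controls, which at the switching time still
    follow the first control. *)
Lemma eq_Rintegral_itv_oc f g a b :
  measurable_fun `[a, b] f -> measurable_fun `[a, b] g ->
  (forall s, a < s <= b -> f s = g s) ->
  \int[mu]_(s in `[a, b]) f s = \int[mu]_(s in `[a, b]) g s.
Proof.
move=> mf mg fg; rewrite /Rintegral; congr fine.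
have sub : `]a, b] `<=` `[a, b] by apply: subset_itvr; rewrite bnd_simp.
rewrite -!integral_itv_obnd_cbnd.
- by apply: eq_integral => s; rewrite inE /= in_itv /= => /fg ->.
- by apply/measurable_EFinP; exact: measurable_funS mg.
- by apply/measurable_EFinP; exact: measurable_funS mf.
Qed.

Lemma ae_itvoo_itvcc a b (Q : R -> Prop) :
  {ae mu, forall s, `]a, b[%classic s -> Q s} ->
  {ae mu, forall s, `[a, b]%classic s -> Q s}.
Proof.
have ae_neq c : {ae mu, forall s, s <> c}.
  exists [set c]; split => //; first exact: lebesgue_measure_set1.
  by move=> s /= /contrapT.
move=> aeQ; have F := ae_filter_ringOfSetsType mu.
have := @filterI _ _ F _ _ aeQ (@filterI _ _ F _ _ (ae_neq a) (ae_neq b)).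
apply: lebesgue_ae_mono => s [Qs [/eqP sa /eqP sb]].
rewrite /= in_itv/= => /andP[ls sl]; apply: Qs.
by rewrite /= in_itv/= !lt_neqAle ls sl eq_sym sa sb.
Qed.

End lebesgue_intervals.

Section euclidean_norm.
Context {R : realType} {n : nat}.

Lemma enorm_ge0 (v : 'rV[R]_n) : 0 <= enorm v.
Proof. exact: sqrtr_ge0. Qed.

Lemma enorm_sqr (v : 'rV[R]_n) : enorm v ^+ 2 = \sum_(i < n) v ord0 i ^+ 2.
Proof. by rewrite sqr_sqrtr// sumr_ge0// => i _; exact: sqr_ge0. Qed.

Lemma ler_coord_enorm (v : 'rV[R]_n) i : `|v ord0 i| <= enorm v.
Proof.
rewrite -(@ler_pXn2r _ 2 isT) ?nnegrE ?enorm_ge0// enorm_sqr real_normK ?num_real//.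
by rewrite (bigD1 i)//= lerDl sumr_ge0// => j _; exact: sqr_ge0.
Qed.

(** [lipschitz] yields the inequality for all constants above some [M]; [|M| + 1] is one of them and
    is nonnegative. *)
Lemma lipschitz_bound (f : 'rV[R]_n -> R) : lipschitz f ->
  exists2 K, 0 <= K & forall x y, `|f x - f y| <= K * `|x - y|.
Proof.
move=> [M [_ fM]].
exists (`|M| + 1) => // x y.
by apply: (fM (`|M| + 1) _ (x, y)) => //; rewrite ltr_pwDr ?ler_norm.
Qed.

Lemma lipschitz_bound_continuous (f : 'rV[R]_n -> R) K : 0 <= K ->
  (forall x y, `|f x - f y| <= K * `|x - y|) -> continuous f.
Proof.
move=> K0 fK x U /nbhs_ballP[e /= e0 eU].
have K1 : 0 < K + 1 by rewrite ltr_wpDl.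
apply/nbhs_ballP; exists (e / (K + 1)); first by rewrite /= divr_gt0.
move=> y; rewrite mx_norm_ball /ball_ /= ltr_pdivlMr// mulrC => xy.
apply: eU; apply: le_lt_trans xy; apply: (le_trans (fK _ _)).
by rewrite ler_wpM2r// lerDl.
Qed.

End euclidean_norm.

(** * Controls: the essential bound, splicing, measurability of the cost *)

Section controls.
Context {R : realType} {n : nat} {T : R}.
Local Notation mu := (@lebesgue_measure R).
Local Notation Omega := (wiener_space n T).
Local Notation D := ([set: Omega] `*` `[0, T]).
Implicit Types (u v : Omega -> R -> 'rV[R]_n) (x y : 'rV[R]_n) (w : Omega).

Definition joint_measurable u :=
  forall i, measurable_fun D (fun p => u p.1 p.2 ord0 i).

Definition path_bounded (C : R) u w :=
  {ae mu, forall s, `[0, T]%classic s -> enorm (u w s) <= C}.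

(** For [T > 0] the restricted measure is nonzero, so the norm is a genuine essential supremum. Null
    sets are transferred by intersecting with ]0, T[ in one direction and by adding its complement
    in the other. *)
Lemma Linfty_normP (f : R -> 'rV[R]_n) C : 0 < T ->
  (Linfty_norm T f <= C%:E)%E <->
  {ae mu, forall s, `[0, T]%classic s -> enorm (f s) <= C}.
Proof.
move=> T0; rewrite /Linfty_norm unlock.
have -> : (0 < mrestr mu (measurable_itv `]0%R, T[%R) [set: R])%E.
  by rewrite /mrestr setTI lebesgue_measure_itv/= lte_fin T0 oppr0 adde0 lte_fin.
split=> [/ess_supP fC|fC]; last apply/ess_supP.
  apply: ae_itvoo_itvcc.
  case: fC => N [mN N0 fN].
  exists (N `&` `]0, T[); split => //; first exact: measurableI.
  move=> s /= /not_implyP[sT fs]; split=> //; apply: fN => /=.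
  by rewrite ger0_norm ?enorm_ge0// lee_fin.
case: fC => N [mN N0 fN].
exists (N `|` ~` `]0, T[%classic); split.
- by apply: measurableU => //; exact: measurableC.
- apply/eqP; rewrite -measure_le0 -N0 /mrestr.
  apply: le_measure; rewrite ?inE//; last by move=> s [[|]].
  by apply: measurableI => //; apply: measurableU => //; exact: measurableC.
- move=> s /= fs; have [sT|sT] := pselect (`]0, T[%classic s); last by right.
  left; apply: fN => /= fC; apply: fs; rewrite ger0_norm ?enorm_ge0// lee_fin.
  by apply: fC; exact: subset_itv_oo_cc.
Qed.

Lemma controls_joint_measurable (P : {measure set Omega -> \bar R}) C u :
  controls P C u -> joint_measurable u.
Proof. by move=> [u_meas _] i; exact: measurable_fun_coord. Qed.

Lemma controls_path_bounded (P : {measure set Omega -> \bar R}) C u : 0 < T ->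
  controls P C u -> {ae P, forall w, path_bounded C u w}.
Proof. by move=> T0 [_]; apply: filterS => w /Linfty_normP; exact. Qed.

(** Since [u] is kept at [s0] itself, identities before the switch hold pointwise on the closed
    interval; those after it ignore one point. *)
Definition splice (s0 : R) u v : Omega -> R -> 'rV[R]_n :=
  fun w s => if s <= s0 then u w s else v w s.

(** Controls are only required to be jointly measurable and essentially bounded, and both properties
    survive pasting at a deterministic time. *)
Lemma controls_splice (P : {measure set Omega -> \bar R}) C s0 u v : 0 < T ->
  controls P C u -> controls P C v -> controls P C (splice s0 u v).
Proof.
move=> T0 uC vC; split.
  apply: measurable_fun_if; first exact: measurable_strip.
  - by apply: measurable_funTS; apply: measurable_fun_ler => //; exact: measurable_snd.
  - apply: measurable_funS uC.1; first exact: measurable_strip.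
    exact: subIsetl.
  - apply: measurable_funS vC.1; first exact: measurable_strip.
    exact: subIsetl.
apply: filterS2 (controls_path_bounded T0 uC) (controls_path_bounded T0 vC) => w uw vw.
apply/Linfty_normP => //.
have := @filterI _ _ (ae_filter_ringOfSetsType mu) _ _ uw vw.
by apply: lebesgue_ae_mono => s [us vs] sT; rewrite /splice; case: ifP => _; auto.
Qed.

Lemma controlledE nu t x u s w i : controlled nu t x u s w ord0 i =
  x ord0 i + \int[mu]_(r in `[t, s]) u w r ord0 i
  + Num.sqrt nu * (Wproc s w ord0 i - Wproc t w ord0 i).
Proof. by rewrite /controlled !mxE. Qed.

Lemma measurable_controlled nu t x u i : 0 <= t <= T -> joint_measurable u ->
  measurable_fun D (fun p => controlled nu t x u p.2 p.1 ord0 i).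
Proof.
move=> tT mju; have /andP[t0 _] := tT.
apply: (eq_measurable_fun (fun p : Omega * R => x ord0 i +
    \int[mu]_(r in `[t, p.2]) u p.1 r ord0 i +
    Num.sqrt nu * (Wproc p.2 p.1 ord0 i - Wproc t p.1 ord0 i))).
  by move=> p _; rewrite controlledE.
apply: measurable_funD.
  apply: measurable_funD => //.
  exact: (measurable_fun_Rintegral_itv (g := fun p => u p.1 p.2 ord0 i)).
apply: measurable_funM => //; apply: measurable_funB.
  exact: measurable_Wproc_strip.
apply: measurable_funTS.
exact: (measurableT_comp (measurable_Wproc t i) measurable_fst).
Qed.

Lemma measurable_controlled_time nu t x u s i : 0 <= t <= T -> 0 <= s <= T ->
  joint_measurable u -> measurable_fun setT (fun w => controlled nu t x u s w ord0 i).
Proof.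
move=> tT sT mju.
exact: (measurable_fun_strip_fst
  (g := fun p => controlled nu t x u p.2 p.1 ord0 i) sT (measurable_controlled _ _ _ tT mju)).
Qed.

Context (V : 'rV[R]_n -> R).

Definition cost_rate nu t x u w s : R :=
  enorm (u w s) ^+ 2 / 2 + V (controlled nu t x u s w).

Context (cV : continuous V).

Lemma measurable_cost_rate nu t x u : 0 <= t <= T -> joint_measurable u ->
  measurable_fun D (fun p => cost_rate nu t x u p.1 p.2).
Proof.
move=> tT mju; apply: measurable_funD.
  apply: measurable_funM => //.
  apply: (eq_measurable_fun (fun p : Omega * R => \sum_(i < n) u p.1 p.2 ord0 i ^+ 2)).
    by move=> p _; rewrite enorm_sqr.
  by apply: measurable_sum => i; apply: measurable_funX; exact: mju.
apply: (measurable_continuous_rV (z := fun p => controlled nu t x u p.2 p.1)) => //.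
  exact: measurable_strip.
by move=> i; exact: measurable_controlled.
Qed.

Lemma measurable_running_cost nu t b x u : 0 <= t <= T -> 0 <= b <= T ->
  joint_measurable u -> measurable_fun setT (running_cost nu V t b x u).
Proof.
move=> tT bT mju; have /andP[t0 _] := tT.
exact: (measurable_fun_strip_fst bT (measurable_fun_Rintegral_itv t0
  (measurable_cost_rate nu x tT mju))).
Qed.

End controls.

(** * Identities and estimates along a fixed path *)

Section pathwise.
Context {R : realType} {n : nat} {T : R}.
Local Notation mu := (@lebesgue_measure R).
Local Notation Omega := (wiener_space n T).
Implicit Types (u v : Omega -> R -> 'rV[R]_n) (x y : 'rV[R]_n) (w : Omega).

Let itv_sub a b : 0 <= a -> b <= T -> `[a, b]%classic `<=` `[0, T]%classic.
Proof.
move=> a0 bT s /=; rewrite !in_itv/= => /andP[as_ sb].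
by rewrite (le_trans a0)//= (le_trans sb).
Qed.

Let itv_finite (a b : R) : (mu `[a, b] < +oo)%E.
Proof.
by rewrite lebesgue_measure_itv/=; case: ifP => _; rewrite ?ltry.
Qed.

Lemma measurable_control_path a b u w i : 0 <= a -> b <= T -> joint_measurable u ->
  measurable_fun `[a, b] (fun s => u w s ord0 i).
Proof.
move=> a0 bT mju; apply: (measurable_funS _ (itv_sub a0 bT)) => //.
exact: (measurable_fun_strip_snd (g := fun p => u p.1 p.2 ord0 i) w (mju i)).
Qed.

Lemma integrable_control_path C a b u w i : 0 <= a -> b <= T ->
  joint_measurable u -> path_bounded C u w ->
  mu.-integrable `[a, b] (EFin \o (fun s => u w s ord0 i)).
Proof.
move=> a0 bT mju uw; apply: (@ae_bounded_integrable _ _ _ C) => //.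
  exact: measurable_control_path.
apply: lebesgue_ae_mono uw => s us sab.
exact: le_trans (ler_coord_enorm _ _) (us (itv_sub a0 bT sab)).
Qed.

(** The drift integral is additive because the control is integrable along the path, and the
    Brownian increments telescope. *)
Lemma controlled_flow C nu t t1 s x u w : 0 <= t -> t <= t1 -> t1 <= s -> s <= T ->
  joint_measurable u -> path_bounded C u w ->
  controlled nu t1 (controlled nu t x u t1 w) u s w = controlled nu t x u s w.
Proof.
move=> t0 tt1 t1s sT mju uw; apply/rowP => i; rewrite !controlledE.
rewrite (Rintegral_itv_split tt1 t1s (integrable_control_path _ t0 sT mju uw)).
ring.
Qed.

(** The drift and the noise do not depend on the state, so they cancel; all the Lipschitz estimates
    rest on this. *)
Lemma controlledB nu t s x y u w :
  controlled nu t y u s w - controlled nu t x u s w = y - x.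
Proof. by apply/rowP => i; rewrite !mxE; ring. Qed.

Section splice.
Context (nu t1 : R) (u v : Omega -> R -> 'rV[R]_n) (w : Omega).

Lemma controlled_splice_left t x s : s <= t1 ->
  controlled nu t x (splice t1 u v) s w = controlled nu t x u s w.
Proof.
move=> st1; apply/rowP => i; rewrite !controlledE; congr (_ + _ + _).
apply: eq_Rintegral => r; rewrite inE /= in_itv/= => /andP[_ rs].
by rewrite /splice (le_trans rs st1).
Qed.

Lemma running_cost_splice_left V t x :
  running_cost nu V t t1 x (splice t1 u v) w = running_cost nu V t t1 x u w.
Proof.
apply: eq_Rintegral => s; rewrite inE /= in_itv/= => /andP[_ st1].
by rewrite controlled_splice_left// /splice st1.
Qed.

Context (t10 : 0 <= t1) (mjv : joint_measurable v).

Lemma controlled_splice_right y s : s <= T ->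
  joint_measurable (splice t1 u v) ->
  controlled nu t1 y (splice t1 u v) s w = controlled nu t1 y v s w.
Proof.
move=> sT mjs; apply/rowP => i; rewrite !controlledE; congr (_ + _ + _).
apply: eq_Rintegral_itv_oc => [||r /andP[t1r _]]; try exact: measurable_control_path.
by rewrite /splice leNgt t1r.
Qed.

End splice.

Section cost.
Context (V : 'rV[R]_n -> R) (M : R).
Context (cV : continuous V) (VM : forall x, `|V x| <= M).

Lemma measurable_cost_path nu t x u w a b : 0 <= t <= T -> 0 <= a -> b <= T ->
  joint_measurable u -> measurable_fun `[a, b] (cost_rate V nu t x u w).
Proof.
move=> tT a0 bT mju; apply: (measurable_funS _ (itv_sub a0 bT)) => //.
exact: (measurable_fun_strip_snd (g := fun p => cost_rate V nu t x u p.1 p.2) w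
  (measurable_cost_rate cV _ _ tT mju)).
Qed.

Lemma integrable_cost_path C nu t x u w a b : 0 <= t <= T -> 0 <= a -> b <= T ->
  joint_measurable u -> path_bounded C u w ->
  mu.-integrable `[a, b] (EFin \o cost_rate V nu t x u w).
Proof.
move=> tT a0 bT mju uw; apply: (@ae_bounded_integrable _ _ _ (C ^+ 2 / 2 + M)) => //.
  exact: measurable_cost_path.
apply: lebesgue_ae_mono uw => s us sab.
rewrite (le_trans (ler_normD _ _))// lerD// ger0_norm ?divr_ge0 ?sqr_ge0//.
have uC := us (itv_sub a0 bT sab).
rewrite ler_pM2r ?invr_gt0// ler_pXn2r ?nnegrE ?enorm_ge0//.
exact: le_trans (enorm_ge0 _) uC.
Qed.

Lemma running_cost_flow C nu t t1 b x u w : 0 <= t -> t <= t1 -> t1 <= b -> b <= T ->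
  joint_measurable u -> path_bounded C u w ->
  running_cost nu V t b x u w = running_cost nu V t t1 x u w +
    running_cost nu V t1 b (controlled nu t x u t1 w) u w.
Proof.
move=> t0 tt1 t1b bT mju uw.
have tT : 0 <= t <= T by rewrite t0 (le_trans tt1)// (le_trans t1b).
rewrite {1}/running_cost.
rewrite (Rintegral_itv_split tt1 t1b (integrable_cost_path _ _ tT t0 bT mju uw)).
congr (_ + _); apply: eq_Rintegral => s; rewrite inE /= in_itv/= => /andP[t1s sb].
by rewrite /cost_rate (controlled_flow _ _ t0 tt1 t1s (le_trans sb bT) mju uw).
Qed.

Lemma running_cost_splice_right nu t1 y u v w : 0 <= t1 <= T ->
  joint_measurable v -> joint_measurable (splice t1 u v) ->
  running_cost nu V t1 T y (splice t1 u v) w = running_cost nu V t1 T y v w.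
Proof.
move=> t1T mjv mjs; have /andP[t10 _] := t1T.
apply: eq_Rintegral_itv_oc => [||s /andP[t1s sT]].
- exact: measurable_cost_path.
- exact: measurable_cost_path.
- by rewrite controlled_splice_right// /splice leNgt t1s.
Qed.

(** The two trajectories differ by [y - x] at all times and the control energies agree, so the rates
    differ by at most [K * |y - x|], integrated over a length [T - t]. *)
Lemma running_cost_lipschitz C K nu t x y u w : 0 <= t <= T ->
  (forall x y, `|V x - V y| <= K * `|x - y|) ->
  joint_measurable u -> path_bounded C u w ->
  running_cost nu V t T y u w <= running_cost nu V t T x u w + K * (T - t) * `|y - x|.
Proof.
move=> tT VK mju uw; have /andP[t0 t_T] := tT.
have ix z := integrable_cost_path nu z tT t0 (lexx T) mju uw.
have ic : mu.-integrable `[t, T] (EFin \o (fun=> K * `|y - x|)).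
  apply: (@ae_bounded_integrable _ _ _ `|K * `|y - x| |) => //.
  by apply: aeW => s _.
have -> : K * (T - t) * `|y - x| = \int[mu]_(s in `[t, T]) (K * `|y - x|).
  have <- : fine (mu `[t, T]) = T - t.
    rewrite lebesgue_measure_itv/= lte_fin.
    have [tT'|Tt] := ltP t T; first by rewrite -EFinB.
    by rewrite (le_anti (introT andP (conj Tt t_T))) subrr.
  by rewrite Rintegral_cst//; ring.
rewrite -[running_cost _ _ _ _ x _ _]/(\int[mu]_(s in `[t, T]) cost_rate V nu t x u w s).
rewrite -(RintegralD _ (ix x) ic)//.
apply: (le_Rintegral _ (ix y) (integrableD _ (ix x) ic)) => //.
move=> s _; rewrite /cost_rate -addrA lerD2l -lerBlDl.
rewrite -(controlledB nu t s x y u w).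
exact: le_trans (ler_norm _) (VK _ _).
Qed.

Context (S : 'rV[R]_n -> R).

(** The cost J(t, x, u), convertible to the family that defines [U]. *)
Definition total_cost nu t x u w : R :=
  running_cost nu V t T x u w + S (controlled nu t x u T w).

Lemma total_cost_flow C nu t t1 x u w : 0 <= t -> t <= t1 -> t1 <= T ->
  joint_measurable u -> path_bounded C u w ->
  total_cost nu t x u w = running_cost nu V t t1 x u w +
    total_cost nu t1 (controlled nu t x u t1 w) u w.
Proof.
move=> t0 tt1 t1T mju uw; rewrite /total_cost (running_cost_flow _ _ t0 tt1 t1T _ mju uw)//.
by rewrite (controlled_flow _ _ t0 tt1 t1T _ mju uw)// addrA.
Qed.

Lemma total_cost_splice_right nu t1 y u v w : 0 <= t1 <= T ->
  joint_measurable v -> joint_measurable (splice t1 u v) ->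
  total_cost nu t1 y (splice t1 u v) w = total_cost nu t1 y v w.
Proof.
move=> t1T mjv mjs; have /andP[t10 _] := t1T.
by rewrite /total_cost running_cost_splice_right// controlled_splice_right.
Qed.

(** The constant depends on neither the control nor the path, so one estimate serves all
    controls. *)
Lemma total_cost_lipschitz C KV KS nu t x y u w : 0 <= t <= T ->
  (forall x y, `|V x - V y| <= KV * `|x - y|) ->
  (forall x y, `|S x - S y| <= KS * `|x - y|) ->
  joint_measurable u -> path_bounded C u w ->
  total_cost nu t y u w <= total_cost nu t x u w + (KV * (T - t) + KS) * `|y - x|.
Proof.
move=> tT VK SK mju uw.
rewrite /total_cost mulrDl addrACA lerD ?(running_cost_lipschitz _ _ _ tT VK mju uw)//.
rewrite -lerBlDl -(controlledB nu t T x y u w).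
exact: le_trans (ler_norm _) (SK _ _).
Qed.

End cost.
End pathwise.

(** * The dynamic programming identity *)

Theorem proposition4p1 (R : realType) (n : nat) (T nu C : R)
    (hT : 0 < T) (hnu : 0 < nu) (hC : 0 < C)
    (P : probability (wiener_space n T) R) (hP : is_wiener_measure P)
    (V S : 'rV[R]_n -> R)
    (hVbounded : bounded_fun V) (hVlip : lipschitz V) (hSlip : lipschitz S)
    (hVint : forall t x u, 0 <= t <= T -> controls P C u ->
      {ae P, forall w, (\int[lebesgue_measure]_(s in `[t, T])
                          `|V (controlled nu t x u s w)|%:E < +oo)%E})
    (hSfin : forall t x u, 0 <= t <= T -> controls P C u ->
      {ae P, forall w, (`|S (controlled nu t x u T w)|%:E < +oo)%E})
    (U : R -> 'rV[R]_n -> wiener_space n T -> \bar R)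
    (hU : is_value_process P C nu V S U)
    (t delta : R) (ht : 0 <= t <= T) (hdelta : 0 <= delta)
    (htdelta : t + delta <= T)
    (Uc : 'rV[R]_n -> wiener_space n T -> R)
    (hUc : is_continuous_version P (U (t + delta)) Uc)
    (Utilde : 'rV[R]_n -> wiener_space n T -> \bar R)
    (hUtilde : forall x, is_ess_inf P (controls P C)
      (fun u w => (running_cost nu V t (t + delta) x u w
                   + Uc (controlled nu t x u (t + delta) w) w)%:E)
      (Utilde x)) :
  forall x, {ae P, forall w, Utilde x w = U t x w}.
Proof.
have /andP[t0 _] := ht.
set t1 := t + delta in htdelta hUc hUtilde *.
have tt1 : t <= t1 by rewrite lerDl.
have t10 : 0 <= t1 := le_trans t0 tt1.
have t1T : 0 <= t1 <= T by rewrite t10.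
have [KV KV0 VK] := lipschitz_bound hVlip.
have [KS _ SK] := lipschitz_bound hSlip.
have cV := lipschitz_bound_continuous KV0 VK.
have [M VM] : exists M : R, forall x, `|V x| <= M.
  move: hVbounded => [M [_ VM]]; exists (`|M| + 1) => x.
  by apply: VM => //; rewrite ltr_pwDr ?ler_norm.
pose L := KV * (T - t1) + KS.
have JL (w : wiener_space n T) y z u (mju : joint_measurable u) (uw : path_bounded C u w) :
    total_cost V S nu t1 y u w <= total_cost V S nu t1 z u w + L * `|y - z|.
  exact: (total_cost_lipschitz cV VM nu _ _ t1T VK SK mju uw).
have Jflow x (w : wiener_space n T) u (mju : joint_measurable u) (uw : path_bounded C u w) :
    total_cost V S nu t x u w = running_cost nu V t t1 x u w +
      total_cost V S nu t1 (controlled nu t x u t1 w) u w.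
  exact: (total_cost_flow cV VM S _ _ t0 tt1 htdelta mju uw).
move=> x.
have [mU Ule Umax] := hU t x ht.
have [mUt Utle Utmax] := hUtilde x.
(* By maximality of [U t x] it suffices that [Utilde x] lies below the total cost of each
   control. *)
have Utilde_le_U : {ae P, forall w, (Utilde x w <= U t x w)%E}.
  apply: Umax => // u uC.
  have mju := controls_joint_measurable uC.
  (* Here [y] is deterministic and the null set depends on it, so the random point cannot be
     substituted directly. *)
  have Uc_le y : {ae P, forall w, Uc y w <= total_cost V S nu t1 y u w}.
    have [_ Ut1le _] := hU t1 y t1T.
    apply: filterS2 (hUc.1 y) (Ut1le _ uC) => w <-.
    by rewrite lee_fin.
  have F : Filter (almost_everywhere P) by exact: ae_filter_ringOfSetsType.
  apply: filterS3 (Utle _ uC) (ae_rat_row Uc_le)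
    (filterI hUc.2 (controls_path_bounded hT uC)) => w Utw Ucw [cUc uw].
  apply: le_trans Utw _; rewrite lee_fin.
  rewrite -/(total_cost V S nu t x u w) Jflow// lerD2l.
  (* At a rational [q] the bound on [Uc q] is moved to the random point at the price
     [L * |Z - q|]. *)
  apply: (ler_rat_row_limit (cUc _) (K := L)) => q.
  by rewrite distrC; exact: le_trans (Ucw q) (JL _ _ _ _ mju uw).
have U_le_Utilde : {ae P, forall w, (U t x w <= Utilde x w)%E}.
  apply: Utmax => // u uC.
  have mju := controls_joint_measurable uC.
  pose Z w := controlled nu t x u t1 w.
  (* The candidate lower bound M - L |Z - y|, extended-real like [U t x]. Being measurable, it may
     compete in the essential infimum that defines [U t1 y]. *)
  pose X y w := (U t x w - (running_cost nu V t t1 x u w + L * `|Z w - y|)%:E)%E.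
  have mX y : measurable_fun setT (X y).
    apply: emeasurable_funB => //; apply/measurable_EFinP; apply: measurable_funD.
      exact: measurable_running_cost.
    apply: measurable_funM => //.
    have cdist : continuous (fun z : 'rV[R]_n => `|z - y|).
      apply: (lipschitz_bound_continuous ler01) => a b.
      by rewrite mul1r (le_trans (ler_dist_dist _ _))// opprB addrA subrK.
    apply: (measurable_continuous_rV measurableT _ cdist (z := Z)) => i.
    exact: measurable_controlled_time.
  have X_le y : {ae P, forall w, (X y w <= (Uc y w)%:E)%E}.
    have [_ _ Ut1max] := hU t1 y t1T.
    suff XU : {ae P, forall w, (X y w <= U t1 y w)%E}.
      by apply: filterS2 (hUc.1 y) XU => w ->.
    apply: Ut1max => // v vC.
    have mjv := controls_joint_measurable vC.
    (* The spliced control bounds [U t x] by the cost of [u] up to [t1] plus J(t1, Z, v), and J(t1,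
       Z, v) is at most J(t1, y, v) + L |Z - y|. *)
    have sC := controls_splice t1 hT uC vC.
    have mjs := controls_joint_measurable sC.
    have F : Filter (almost_everywhere P) by exact: ae_filter_ringOfSetsType.
    apply: filterS3 (Ule _ sC) (controls_path_bounded hT sC)
      (controls_path_bounded hT vC) => w Uw sw vw.
    rewrite leeBlDr//; apply: le_trans Uw _.
    rewrite -/(total_cost V S nu t x _ w) Jflow// running_cost_splice_left.
    rewrite controlled_splice_left// (total_cost_splice_right cV)//.
    rewrite -EFinD lee_fin [leRHS]addrCA lerD2l.
    exact: JL.
  apply: filterS2 (ae_rat_row X_le) hUc.2 => w Xw cUc.
  (* The value -oo is trivial; +oo is refuted at the rational point 0, where [X] would be +oo yet
     below a real number. *)
  move: Xw; rewrite /X; case: (U t x w) => [r| |] Xw; last exact: leNye.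
    rewrite lee_fin -lerBlDl -[leRHS]opprK lerNr.
    (* The limit lemma gives upper bounds, so the lower bound on [Uc] is passed to the limit through
       its opposite. *)
    apply: (@ler_rat_row_limit _ _ (fun z => - Uc z w) _ L (Z w)).
      exact: cvgN (cUc (Z w)).
    move=> q; have := Xw q; rewrite -EFinB lee_fin. lra.
  by have := Xw 0.
by apply: filterS2 Utilde_le_U U_le_Utilde => w le1 le2; apply/le_anti/andP.
Qed.
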